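(* Let $G$ be a group. Then $\mathbf{TSpan}_G$ is a braided strict monoidal category, with tensor defined on objects by $G^m\otimes G^n=G^{m+n}$ (and on arrows by the product of spans), and with twist $\tau_{m,n}:G^m\otimes G^n\to G^n\otimes G^m$ the span determined by the function (with left leg the identity and right leg $\delta_1$) $$\delta_1(x_1,\dots,x_m,y_1,\dots,y_n)=(y_1^{\overline{x}},\dots,y_n^{\overline{x}},x_1,\dots,x_m),$$ where $\overline{x}=x_1x_2\cdots x_m$ and $y^x=xyx^{-1}$.
   Context: Definition of $\mathbf{TSpan}_G$: the objects are the formal powers $G^n$ ($n\ge 0$) of $G$. An arrow from $G^m$ to $G^n$ is an isomorphism class of spans of sets $G^m\xleftarrow{\delta_0}S\xrightarrow{\delta_1}G^n$ such that there exists a function $G\times S\to S$, written $(g,s)\mapsto gs$, for which $s\mapsto gs$ is a bijection for each $g\in G$, and satisfying: 1) if $\delta_0(s)=(x_1,\dots,x_m)$ and $\delta_1(s)=(y_1,\dots,y_n)$ then $\delta_0(gs)=(x_1^g,\dots,x_m^g)$ and $\delta_1(gs)=(y_1^g,\dots,y_n^g)$ for all $g\in G$, where $x^g=gxg^{-1}$; 2) if $\delta_0(s)=(x_1,\dots,x_m)$ and $\delta_1(s)=(y_1,\dots,y_n)$ then $x_1\cdots x_m(y_1\cdots y_n)^{-1}\in Z(G)$, the center of $G$. Composition (by pullback) and identities are those of spans. The product of two spans is formed by taking cartesian products of the apexes and of the legs. Braided strict monoidal category: a category $\mathbf{C}$ with a functor $\otimes:\mathbf{C}\times\mathbf{C}\to\mathbf{C}$,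 strictly associative and strictly unital with a unit object $I$ on objects and arrows, and a natural family of isomorphisms $\tau_{A,B}:A\otimes B\to B\otimes A$ such that (composition written right to left) $\tau_{A,B\otimes C}=(1_B\otimes\tau_{A,C})(\tau_{A,B}\otimes 1_C)$ and $\tau_{A\otimes B,C}=(\tau_{A,C}\otimes 1_B)(1_A\otimes\tau_{B,C})$. *)

(* Defs.v *)
From HB Require Import structures.
From mathcomp Require Import all_boot.

Set Implicit Arguments.
Unset Strict Implicit.
Unset Printing Implicit Defensive.

(* [compm g f] is "g after f"; equality of arrows is Leibniz equality. *)
Record category (Obj : Type) (Hom : Obj -> Obj -> Type) := Category {
  idm : forall A, Hom A A;
  compm : forall A B C, Hom B C -> Hom A B -> Hom A C;
  compm1l : forall A B (f : Hom A B), compm (idm B) f = f;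
  compm1r : forall A B (f : Hom A B), compm f (idm A) = f;
  compmA : forall A B C D (h : Hom C D) (g : Hom B C) (f : Hom A B),
    compm h (compm g f) = compm (compm h g) f
}.

(* Strict associativity and unitality identify objects that are equal but not
   convertible, so equations between arrows are stated up to transport along
   these equalities of objects. *)
Definition hom_cast (Obj : Type) (Hom : Obj -> Obj -> Type) (A A' B B' : Obj)
    (eA : A = A') (eB : B = B') (f : Hom A B) : Hom A' B' :=
  ecast X (Hom X B') eA (ecast Y (Hom A Y) eB f).

Record strict_monoidal (Obj : Type) (Hom : Obj -> Obj -> Type)
    (C : category Hom) (tens : Obj -> Obj -> Obj) (I : Obj) := StrictMonoidal {
  tensm : forall A B A' B',
    Hom A A' -> Hom B B' -> Hom (tens A B) (tens A' B');
  tensm_id : forall A B, tensm (idm C A) (idm C B) = idm C (tens A B);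
  tensm_comp : forall A B A' B' A'' B'' (f' : Hom A' A'') (g' : Hom B' B'')
      (f : Hom A A') (g : Hom B B'),
    tensm (compm C f' f) (compm C g' g) = compm C (tensm f' g') (tensm f g);
  tensA : forall A B D, tens A (tens B D) = tens (tens A B) D;
  tens1o : forall A, tens I A = A;
  tenso1 : forall A, tens A I = A;
  tensmA : forall A B D A' B' D'
      (f : Hom A A') (g : Hom B B') (h : Hom D D'),
    hom_cast (tensA A B D) (tensA A' B' D') (tensm f (tensm g h))
    = tensm (tensm f g) h;
  tensm1m : forall A A' (f : Hom A A'),
    hom_cast (tens1o A) (tens1o A') (tensm (idm C I) f) = f;
  tensmm1 : forall A A' (f : Hom A A'),
    hom_cast (tenso1 A) (tenso1 A') (tensm f (idm C I)) = f
}.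

Record braided (Obj : Type) (Hom : Obj -> Obj -> Type) (C : category Hom)
    (tens : Obj -> Obj -> Obj) (I : Obj) (M : strict_monoidal C tens I) :=
  Braided {
  braid : forall A B, Hom (tens A B) (tens B A);
  braid_iso : forall A B, exists t : Hom (tens B A) (tens A B),
    compm C t (braid A B) = idm C (tens A B)
    /\ compm C (braid A B) t = idm C (tens B A);
  braid_natural : forall A B A' B' (f : Hom A A') (g : Hom B B'),
    compm C (braid A' B') (tensm M f g) = compm C (tensm M g f) (braid A B);
  braid_tensr : forall A B D,
    hom_cast (tensA M A B D) (esym (tensA M B D A)) (braid A (tens B D))
    = compm C (tensm M (idm C B) (braid A D))
        (hom_cast (erefl _) (esym (tensA M B A D))
           (tensm M (braid A B) (idm C D)));
  braid_tensl : forall A B D,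
    hom_cast (esym (tensA M A B D)) (tensA M D A B) (braid (tens A B) D)
    = compm C (tensm M (braid A D) (idm C B))
        (hom_cast (erefl _) (tensA M A D B)
           (tensm M (idm C A) (braid B D)))
}.

Record span (A B : Type) := Span {
  apex : Type;
  dom_leg : apex -> A;
  cod_leg : apex -> B
}.

Definition span_iso (A B : Type) (S T : span A B) : Prop :=
  exists f : apex S -> apex T,
    [/\ bijective f,
        forall s, dom_leg (f s) = dom_leg s
      & forall s, cod_leg (f s) = cod_leg s].

Definition span_of_fun (A B : Type) (f : A -> B) : span A B :=
  Span (fun a : A => a) f.

Definition span_id (A : Type) : span A A := span_of_fun (fun a : A => a).

(* Composition "T after S", by pullback. *)
Definition span_comp (A B D : Type) (T : span B D) (S : span A B) : span A D :=
  @Span A D {p : apex S * apex T | cod_leg p.1 = dom_leg p.2}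
    (fun p => dom_leg (sval p).1) (fun p => cod_leg (sval p).2).

Section TSpan.
Local Open Scope group_scope.
Variable G : groupType.

(* [x ^ g] in the library is the right conjugate [g^-1 * (x * g)]. *)
Definition lconjg (g x : G) : G := g * x * g^-1.

Definition in_center (z : G) : Prop := forall g : G, commute z g.

Definition tprod n (x : n.-tuple G) : G := \prod_(a <- x) a.

(* The map [act] is not required to be a group action. *)
Definition is_tspan m n (S : span (m.-tuple G) (n.-tuple G)) : Prop :=
  (exists act : G -> apex S -> apex S,
     [/\ forall g, bijective (act g),
         forall g s, dom_leg (act g s) = map_tuple (lconjg g) (dom_leg s)
       & forall g s, cod_leg (act g s) = map_tuple (lconjg g) (cod_leg s)])
  /\ (forall s : apex S,
        in_center (tprod (dom_leg s) * (tprod (cod_leg s))^-1)).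

(* The object [G^n] is represented by [n], since distinct formal powers are
   distinct objects. An arrow is an isomorphism class of spans, given by its
   membership predicate. ([classical_sets.set] cannot be used here: it would
   force the universe of spans below that of tuples.) *)
Record tspan (m n : nat) := TSpan {
  tspan_class :> span (m.-tuple G) (n.-tuple G) -> Prop;
  tspan_classP : exists2 S, is_tspan S & tspan_class = span_iso S
}.

(* The product of two spans, read through [G^m * G^n = G^(m + n)]. *)
Definition span_prod m n m' n' (S : span (m.-tuple G) (m'.-tuple G))
    (T : span (n.-tuple G) (n'.-tuple G)) :
    span ((m + n).-tuple G) ((m' + n').-tuple G) :=
  @Span _ _ (apex S * apex T)%type
    (fun p => cat_tuple (dom_leg p.1) (dom_leg p.2))
    (fun p => cat_tuple (cod_leg p.1) (cod_leg p.2)).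

Definition ltuple m n (z : (m + n).-tuple G) : m.-tuple G :=
  [tuple tnth z (lshift n i) | i < m].

Definition rtuple m n (z : (m + n).-tuple G) : n.-tuple G :=
  [tuple tnth z (rshift m j) | j < n].

Definition twist_fun m n (z : (m + n).-tuple G) : (n + m).-tuple G :=
  let x := ltuple z in let y := rtuple z in
  cat_tuple (map_tuple (lconjg (tprod x)) y) x.

Definition twist_span m n : span ((m + n).-tuple G) ((n + m).-tuple G) :=
  span_of_fun (@twist_fun m n).

End TSpan.

(* Main.v *)
(* Each axiom is checked on representing spans, where it amounts to an
   isomorphism of apexes compatible with the legs. The coherence axioms only
   involve spans of functions, which compose and multiply as functions, so they
   reduce to identities between maps of tuples. Naturality of the twist is the
   one place where the structure on spans is used: the action supplies the
   isomorphism of apexes, and the condition modulo the center makes the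
   codomain legs agree. *)

Require Import Defs.
From mathcomp Require Import all_boot.
From mathcomp Require Import boolp.

Set Implicit Arguments.
Unset Strict Implicit.
Unset Printing Implicit Defensive.

(** * Spans up to isomorphism: composition laws *)

Lemma span_iso_refl (A B : Type) (S : span A B) : span_iso S S.
Proof. by exists id; split=> //; exists id. Qed.

Lemma span_iso_sym (A B : Type) (S T : span A B) :
  span_iso S T -> span_iso T S.
Proof.
case=> f [[g fK gK] df cf]; exists g; split; first by exists f.
  by move=> t; rewrite -df gK.
by move=> t; rewrite -cf gK.
Qed.

Lemma span_iso_trans (A B : Type) (S T U : span A B) :
  span_iso S T -> span_iso T U -> span_iso S U.
Proof.
case=> f [bf df cf] [g [bg dg cg]]; exists (g \o f); split.
- exact: bij_comp.
- by move=> s /=; rewrite dg df.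
- by move=> s /=; rewrite cg cf.
Qed.

(** The matching condition is a proposition, so proof irrelevance applies. Later equalities between
    points of a pullback are thereby reduced to equalities of pairs. *)
Lemma pullback_inj (A B D : Type) (T : span B D) (S : span A B) :
  injective (fun p : apex (span_comp T S) => sval p).
Proof.
by move=> [p hp] [q hq] /= e; subst q; rewrite (Prop_irrelevance hp hq).
Qed.

Lemma span_comp_iso (A B D : Type) (S S' : span A B) (T T' : span B D) :
  span_iso S S' -> span_iso T T' ->
  span_iso (span_comp T S) (span_comp T' S').
Proof.
case=> f [[f' fK fK'] df cf] [g [[g' gK gK'] dg cg]].
have h (p : apex (span_comp T S)) :
    cod_leg (f (sval p).1) = dom_leg (g (sval p).2).
  by rewrite cf dg (svalP p).
have h' (p : apex (span_comp T' S')) :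
    cod_leg (f' (sval p).1) = dom_leg (g' (sval p).2).
  by rewrite -cf -dg fK' gK' (svalP p).
exists (fun p => exist _ (f (sval p).1, g (sval p).2) (h p)); split.
- exists (fun p => exist _ (f' (sval p).1, g' (sval p).2) (h' p)) => p;
    apply: pullback_inj; rewrite /= ?fK ?gK ?fK' ?gK';
    by case: (sval p).
- by move=> p /=; rewrite df.
- by move=> p /=; rewrite cg.
Qed.

Lemma span_comp1l (A B : Type) (S : span A B) :
  span_iso (span_comp (span_id B) S) S.
Proof.
(* In the direction [s |-> (s, cod_leg s)] both leg conditions hold by computation; the matching
   condition is only needed to invert the map. *)
apply: span_iso_sym.
exists (fun s => exist (fun p : apex S * apex (span_id B) =>
  cod_leg p.1 = dom_leg p.2) (s, cod_leg s) erefl).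
split=> //; exists (fun p => (sval p).1) => // p.
by apply: pullback_inj; rewrite /= (svalP p); case: (sval p).
Qed.

Lemma span_comp1r (A B : Type) (S : span A B) :
  span_iso (span_comp S (span_id A)) S.
Proof.
apply: span_iso_sym.
exists (fun s => exist (fun p : apex (span_id A) * apex S =>
  cod_leg p.1 = dom_leg p.2) (dom_leg s, s) erefl).
split=> //; exists (fun p => (sval p).2) => // p.
by apply: pullback_inj; rewrite /= -(svalP p); case: (sval p).
Qed.

Lemma span_compA (A B D E : Type) (U : span D E) (T : span B D)
    (S : span A B) :
  span_iso (span_comp U (span_comp T S)) (span_comp (span_comp U T) S).
Proof.
have h1 (p : apex (span_comp U (span_comp T S))) :
    cod_leg (sval (sval p).1).2 = dom_leg (sval p).2 by rewrite -(svalP p).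
pose f1 p : apex (span_comp U T) :=
  exist _ ((sval (sval p).1).2, (sval p).2) (h1 p).
have h2 p : cod_leg (sval (sval p).1).1 = dom_leg (f1 p).
  by rewrite /= (svalP (sval p).1).
have k1 (p : apex (span_comp (span_comp U T) S)) :
    cod_leg (sval p).1 = dom_leg (sval (sval p).2).1 by rewrite (svalP p).
pose g1 p : apex (span_comp T S) :=
  exist _ ((sval p).1, (sval (sval p).2).1) (k1 p).
have k2 p : cod_leg (g1 p) = dom_leg (sval (sval p).2).2.
  by rewrite /= (svalP (sval p).2).
exists (fun p => exist _ ((sval (sval p).1).1, f1 p) (h2 p)); split=> //.
exists (fun p => exist _ (g1 p, (sval (sval p).2).2) (k2 p)) => p;
  apply: pullback_inj => /=.
- case: p h1 @f1 h2 => -[[[s t] e] u] e' h1 f1 h2 /=.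
  by congr pair; apply: pullback_inj.
- case: p k1 @g1 k2 => -[s [[t u] e]] e' k1 g1 k2 /=.
  by congr pair; apply: pullback_inj.
Qed.

Lemma span_of_fun_comp (A B D : Type) (g : B -> D) (f : A -> B) :
  span_iso (span_comp (span_of_fun g) (span_of_fun f))
           (span_of_fun (g \o f)).
Proof.
apply: span_iso_sym.
exists (fun a => exist (fun p : A * B => f p.1 = p.2) (a, f a) erefl).
split=> //; exists (fun p => (sval p).1) => // p.
by apply: pullback_inj => /=; case: p => -[a b] /= <-.
Qed.

Lemma eq_span_of_fun (A B : Type) (f g : A -> B) :
  f =1 g -> span_iso (span_of_fun f) (span_of_fun g).
Proof. by move=> e; exists id; split=> //; exists id. Qed.

Section TSpan.
Local Open Scope group_scope.
Variable G : groupType.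
Implicit Types (m n p : nat) (g h : G) (s t : seq G).

(** * Conjugation and the center *)

Lemma lconjgM g h x : lconjg (g * h) x = lconjg g (lconjg h x).
Proof. by rewrite /lconjg invgM !mulgA. Qed.

Lemma lconjg1 x : lconjg (1 : G) x = x.
Proof. by rewrite /lconjg mul1g invg1 mulg1. Qed.

Lemma lconjgMr g : {morph @lconjg G g : x y / x * y}.
Proof. by move=> x y; rewrite /lconjg !mulgA mulgVK. Qed.

Lemma lconjgK g : cancel (lconjg g) (lconjg g^-1).
Proof. by move=> x; rewrite -lconjgM mulVg lconjg1. Qed.

Lemma lconjgVK g : cancel (lconjg g^-1) (lconjg g).
Proof. by move=> x; rewrite -lconjgM mulgV lconjg1. Qed.

Lemma map_tuple_lconjg_bij n g : bijective (map_tuple (n:=n) (lconjg g)).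
Proof.
exists (map_tuple (n:=n) (lconjg g^-1)) => x; apply: val_inj => /=.
  by rewrite (mapK (lconjgK g)).
by rewrite (mapK (lconjgVK g)).
Qed.

Lemma in_center1 : in_center (1 : G).
Proof. by move=> g; rewrite /commute mul1g mulg1. Qed.

Lemma in_centerM (z w : G) : in_center z -> in_center w -> in_center (z * w).
Proof.
by move=> cz cw g; rewrite /commute -mulgA (cw g) mulgA (cz g) mulgA.
Qed.

(** Write [g] as [(g * h^-1) * h]: the first factor is central, so conjugating by it does nothing.
    Naturality of the twist draws on condition 2 through this fact. *)
Lemma lconjg_center g h x : in_center (g * h^-1) -> lconjg g x = lconjg h x.
Proof.
move=> c; rewrite -[g](mulgVK h) lconjgM {1}/lconjg.
by rewrite c -mulgA mulgV mulg1.
Qed.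

Lemma prod_lconjg g s :
  \prod_(a <- map (lconjg g) s) a = lconjg g (\prod_(a <- s) a).
Proof.
rewrite big_map; elim: s => [|a s IHs]; last by rewrite !big_cons IHs lconjgMr.
by rewrite !big_nil /lconjg mulg1 mulgV.
Qed.

(** * Blocks of tuples and the twist function *)

Lemma ltupleE m n (z : (m + n).-tuple G) : ltuple z = take m z :> seq G.
Proof.
have sz : size (take m z) = m by rewrite size_takel // size_tuple leq_addr.
apply: (@eq_from_nth _ 1) => [|i]; first by rewrite size_tuple sz.
rewrite size_tuple => lt_im.
by rewrite -(tnth_nth _ _ (Ordinal lt_im)) tnth_mktuple nth_take // (tnth_nth 1).
Qed.

Lemma rtupleE m n (z : (m + n).-tuple G) : rtuple z = drop m z :> seq G.
Proof.
apply: (@eq_from_nth _ 1) => [|i].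
  by rewrite size_drop !size_tuple addKn.
rewrite size_tuple => lt_in.
by rewrite -(tnth_nth _ _ (Ordinal lt_in)) tnth_mktuple nth_drop (tnth_nth 1).
Qed.

Lemma cat_ltuple_rtuple m n (z : (m + n).-tuple G) :
  cat_tuple (ltuple z) (rtuple z) = z.
Proof. by apply: val_inj; rewrite /= ltupleE rtupleE cat_take_drop. Qed.

Lemma ltuple_cat m n (x : m.-tuple G) (y : n.-tuple G) :
  ltuple (cat_tuple x y) = x.
Proof. by apply: val_inj; rewrite /= ltupleE /= take_size_cat ?size_tuple. Qed.

Lemma rtuple_cat m n (x : m.-tuple G) (y : n.-tuple G) :
  rtuple (cat_tuple x y) = y.
Proof. by apply: val_inj; rewrite /= rtupleE /= drop_size_cat ?size_tuple. Qed.

(** Together with [cat_ltuple_rtuple], this lets the twist be computed on explicit blocks, as in the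
    coherence laws below. *)
Lemma twist_fun_cat m n (x : m.-tuple G) (y : n.-tuple G) :
  twist_fun (cat_tuple x y) = cat_tuple (map_tuple (lconjg (tprod x)) y) x.
Proof. by rewrite /twist_fun ltuple_cat rtuple_cat. Qed.

Lemma val_twist_fun m n (z : (m + n).-tuple G) :
  twist_fun z =
    map (lconjg (\prod_(a <- take m z) a)) (drop m z) ++ take m z :> seq G.
Proof. by rewrite /= rtupleE ltupleE /tprod ltupleE. Qed.

(** The twist leaves the block [x] intact at the end of its output, so the conjugating element can
    be read off there and undone. *)
Definition untwist_fun m n (z : (n + m).-tuple G) : (m + n).-tuple G :=
  cat_tuple (rtuple z)
    (map_tuple (lconjg (tprod (rtuple z))^-1) (ltuple z)).

Lemma twist_funK m n : cancel (@twist_fun G m n) (@untwist_fun m n).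
Proof.
move=> z; rewrite -[z]cat_ltuple_rtuple twist_fun_cat /untwist_fun.
rewrite ltuple_cat rtuple_cat; congr cat_tuple; apply: val_inj.
by rewrite /= (mapK (lconjgK _)).
Qed.

Lemma untwist_funK m n : cancel (@untwist_fun m n) (@twist_fun G m n).
Proof.
move=> z; rewrite -[z]cat_ltuple_rtuple /untwist_fun ltuple_cat rtuple_cat.
rewrite twist_fun_cat; congr cat_tuple; apply: val_inj.
by rewrite /= (mapK (lconjgVK _)).
Qed.

(** * Spans of functions, composites and products in TSpan *)

Definition conj_equivariant m n (f : m.-tuple G -> n.-tuple G) :=
  forall g x, f (map_tuple (lconjg g) x) = map_tuple (lconjg g) (f x).

(** The apex is the domain itself, so conjugation of tuples serves as the action, and the element
    required to be central is 1. *)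
Lemma is_tspan_of_fun m n (f : m.-tuple G -> n.-tuple G) :
  conj_equivariant f -> (forall x, tprod (f x) = tprod x) ->
  is_tspan (span_of_fun f).
Proof.
move=> ef pf; split=> [|x /=]; last by rewrite pf mulgV; exact: in_center1.
exists (fun g => map_tuple (lconjg g)); split=> // g.
exact: map_tuple_lconjg_bij.
Qed.

Lemma is_tspan_id n : is_tspan (span_id (n.-tuple G)).
Proof. exact: is_tspan_of_fun. Qed.

(** Conjugating [y] by [g] and then by [g x g^-1] is the same as conjugating by [x] and then by [g],
    since the inner [g^-1 g] cancel. *)
Lemma twist_equivariant m n : conj_equivariant (@twist_fun G m n).
Proof.
move=> g z; apply: val_inj.
rewrite [LHS]val_twist_fun /= -map_take -map_drop map_cat rtupleE ltupleE.
congr (_ ++ _); rewrite -!map_comp; apply: eq_map => x /=.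
rewrite prod_lconjg /tprod ltupleE /lconjg.
by rewrite !invgM !mulgA !mulgVK !invgK mulgVK.
Qed.

(** With [x] and [y] the products of the two blocks, this is [(x y x^-1) x = x y]. *)
Lemma tprod_twist m n (z : (m + n).-tuple G) : tprod (twist_fun z) = tprod z.
Proof.
rewrite -{2}[z]cat_ltuple_rtuple /tprod /= !big_cat /= prod_lconjg.
by rewrite /lconjg -/(tprod _) mulgVK.
Qed.

Lemma is_tspan_twist m n : is_tspan (twist_span G m n).
Proof.
by apply: is_tspan_of_fun; [exact: twist_equivariant | exact: tprod_twist].
Qed.

(** Both conditions are inherited from the twist, of which this is the inverse function. *)
Lemma is_tspan_untwist m n : is_tspan (span_of_fun (@untwist_fun m n)).
Proof.
apply: is_tspan_of_fun => [g|] z.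
  by apply: (can_inj (@twist_funK m n)); rewrite twist_equivariant !untwist_funK.
by rewrite -tprod_twist untwist_funK.
Qed.

(** Acting on both components stays in the pullback because [g] conjugates both middle legs. For the
    center, [(x y^-1) (y z^-1) = x z^-1]. *)
Lemma is_tspan_comp m n p (T : span (n.-tuple G) (p.-tuple G))
    (S : span (m.-tuple G) (n.-tuple G)) :
  is_tspan T -> is_tspan S -> is_tspan (span_comp T S).
Proof.
case=> -[b [bb db cb]] zT [[a [ba da ca]] zS]; split; last first.
  move=> q /=; have := in_centerM (zS (sval q).1) (zT (sval q).2).
  by rewrite (svalP q) mulgA mulgVK.
have h g (q : apex (span_comp T S)) :
    cod_leg (a g (sval q).1) = dom_leg (b g (sval q).2).
  by rewrite ca db (svalP q).
exists (fun g q => exist _ (a g (sval q).1, b g (sval q).2) (h g q)).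
split=> [g|g q|g q] /=; [|exact: da|exact: cb].
have [a' aK aK'] := ba g; have [b' bK bK'] := bb g.
have h' (q : apex (span_comp T S)) :
    cod_leg (a' (sval q).1) = dom_leg (b' (sval q).2).
  (* The inverses also preserve matching: this may be checked after conjugating by [g], where they
     cancel against [a g] and [b g]. *)
  apply: (bij_inj (map_tuple_lconjg_bij n g)).
  by rewrite -ca -db aK' bK' (svalP q).
exists (fun q => exist _ (a' (sval q).1, b' (sval q).2) (h' q)) => q;
  by apply: pullback_inj; rewrite /= ?aK ?bK ?aK' ?bK'; case: (sval q).
Qed.

(** For the center, [x x' (y y')^-1 = x (x' y'^-1) y^-1], and the central middle factor can be moved
    to the front. *)
Lemma is_tspan_prod m n m' n' (S : span (m.-tuple G) (m'.-tuple G))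
    (T : span (n.-tuple G) (n'.-tuple G)) :
  is_tspan S -> is_tspan T -> is_tspan (span_prod S T).
Proof.
case=> -[a [ba da ca]] zS [[b [bb db cb]] zT]; split.
  exists (fun g q => (a g q.1, b g q.2)); split=> [g|g q|g q].
  - have [a' aK aK'] := ba g; have [b' bK bK'] := bb g.
    by exists (fun q => (a' q.1, b' q.2)) => -[s t];
      rewrite /= ?aK ?bK ?aK' ?bK'.
  - by apply: val_inj; rewrite /= da db map_cat.
  - by apply: val_inj; rewrite /= ca cb map_cat.
move=> -[s t] /=; have := in_centerM (zT t) (zS s).
rewrite /tprod !big_cat /= -!/(tprod _) invgM.
by rewrite [X in in_center X -> _]mulgA (zT t _) !mulgA.
Qed.

(** * Products and casts of spans up to isomorphism *)

Lemma span_prod_iso m n m' n' (S S' : span (m.-tuple G) (m'.-tuple G))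
    (T T' : span (n.-tuple G) (n'.-tuple G)) :
  span_iso S S' -> span_iso T T' ->
  span_iso (span_prod S T) (span_prod S' T').
Proof.
case=> f [[f' fK fK'] df cf] [g [[g' gK gK'] dg cg]].
exists (fun q => (f q.1, g q.2)); split=> [|q|q] /=.
- by exists (fun q => (f' q.1, g' q.2)) => -[s t];
    rewrite /= ?fK ?gK ?fK' ?gK'.
- by rewrite df dg.
- by rewrite cf cg.
Qed.

Lemma cat_tuple_inj m n (x x' : m.-tuple G) (y y' : n.-tuple G) :
  cat_tuple x y = cat_tuple x' y' -> x = x' /\ y = y'.
Proof.
by move=> e; rewrite -(ltuple_cat x y) -{2}(rtuple_cat x y) e ltuple_cat rtuple_cat.
Qed.

(** The middle four components are interchanged. Matching of the concatenated legs splits into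
    matching of each pair because the block lengths are fixed. *)
Lemma span_prod_comp m n m' n' m'' n''
    (S : span (m.-tuple G) (m'.-tuple G))
    (S' : span (m'.-tuple G) (m''.-tuple G))
    (T : span (n.-tuple G) (n'.-tuple G))
    (T' : span (n'.-tuple G) (n''.-tuple G)) :
  span_iso (span_prod (span_comp S' S) (span_comp T' T))
           (span_comp (span_prod S' T') (span_prod S T)).
Proof.
have h (q : apex (span_prod (span_comp S' S) (span_comp T' T))) :
    cod_leg (s := span_prod S T) ((sval q.1).1, (sval q.2).1) =
    dom_leg (s := span_prod S' T') ((sval q.1).2, (sval q.2).2).
  by rewrite /= (svalP q.1) (svalP q.2).
have k (q : apex (span_comp (span_prod S' T') (span_prod S T))) :
    cod_leg (sval q).1.1 = dom_leg (sval q).2.1 /\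
    cod_leg (sval q).1.2 = dom_leg (sval q).2.2.
  exact/cat_tuple_inj/(svalP q).
pose k1 q : apex (span_comp S' S) :=
  exist _ ((sval q).1.1, (sval q).2.1) (k q).1.
pose k2 q : apex (span_comp T' T) :=
  exist _ ((sval q).1.2, (sval q).2.2) (k q).2.
exists (fun q => exist _ (((sval q.1).1, (sval q.2).1),
                          ((sval q.1).2, (sval q.2).2)) (h q)); split=> //.
exists (fun q => (k1 q, k2 q)) => q.
  case: q h => -[[s s'] e] [[t t'] e'] h; rewrite {}/k1 {}/k2 /=.
  by congr (_, _); apply: eq_exist.
apply: (@pullback_inj _ _ _ (span_prod S' T') (span_prod S T)) => /=.
by case: (sval q) => -[? ?] [? ?].
Qed.

Lemma span_prod_of_fun m n m' n' (f : m.-tuple G -> m'.-tuple G)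
    (g : n.-tuple G -> n'.-tuple G) :
  span_iso (span_prod (span_of_fun f) (span_of_fun g))
    (span_of_fun (fun z => cat_tuple (f (ltuple z)) (g (rtuple z)))).
Proof.
exists (fun q => cat_tuple q.1 q.2); split=> [|//|q /=]; last first.
  by rewrite ltuple_cat rtuple_cat.
exists (fun z => (ltuple z, rtuple z)) => [[x y]|z] /=.
  by rewrite ltuple_cat rtuple_cat.
exact: cat_ltuple_rtuple.
Qed.

Lemma span_prod_id m n :
  span_iso (span_prod (span_id (m.-tuple G)) (span_id (n.-tuple G)))
    (span_id ((m + n).-tuple G)).
Proof.
apply: span_iso_trans (span_prod_of_fun _ _) _; apply: eq_span_of_fun => z.
exact: cat_ltuple_rtuple.
Qed.

(** Counterpart of [hom_cast] on representatives: the apex is untouched and only the legs are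
    transported. *)
Definition span_cast m m' n n' (em : m = m') (en : n = n')
    (S : span (m.-tuple G) (n.-tuple G)) : span (m'.-tuple G) (n'.-tuple G) :=
  Span (fun s : apex S => tcast em (dom_leg s))
       (fun s : apex S => tcast en (cod_leg s)).

Lemma span_cast_of_fun m m' n n' (em : m = m') (en : n = n')
    (f : m.-tuple G -> n.-tuple G) :
  span_iso (span_cast em en (span_of_fun f))
    (span_of_fun (fun z => tcast en (f (tcast (esym em) z)))).
Proof.
exists (tcast em); split=> // [|z /=]; last by rewrite tcastK.
by exists (tcast (esym em)); [exact: tcastK | exact: tcastKV].
Qed.

(* The apex of the left-hand side is [S * T], that of the right-hand side is
   [T * S]; the isomorphism is [(s, t) |-> (x t, s)] with [x] the product of
   [dom_leg s]. The codomain legs then differ by conjugation by [x] against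
   conjugation by the product of [cod_leg s], which agree because these two
   products agree modulo the center. Choice is needed to invert [t |-> x t]
   for all [x] at once. *)
Lemma span_twist_natural m n m' n' (S : span (m.-tuple G) (m'.-tuple G))
    (T : span (n.-tuple G) (n'.-tuple G)) :
  is_tspan S -> is_tspan T ->
  span_iso (span_comp (twist_span G m' n') (span_prod S T))
           (span_comp (span_prod T S) (twist_span G m n)).
Proof.
case=> _ zS [[b [bb db cb]] _].
have /choice[b' bK] g : exists b' : apex T -> apex T,
    cancel (b g) b' /\ cancel b' (b g).
  by have [b' ? ?] := bb g; exists b'.
pose x (s : apex S) := tprod (dom_leg s).
pose src (q : apex (span_comp (twist_span G m' n') (span_prod S T))) :=
  (sval q).1.
pose tgt (q : apex (span_comp (span_prod T S) (twist_span G m n))) :=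
  (sval q).2.
have h q : cod_leg (s := twist_span G m n)
      (cat_tuple (dom_leg (src q).1) (dom_leg (src q).2)) =
    dom_leg (s := span_prod T S) (b (x (src q).1) (src q).2, (src q).1).
  by rewrite /= twist_fun_cat db.
pose st q := ((tgt q).2, b' (x (tgt q).2) (tgt q).1).
have k q : cod_leg (s := span_prod S T) (st q) =
    dom_leg (s := twist_span G m' n')
      (cat_tuple (cod_leg (st q).1) (cod_leg (st q).2)) by [].
exists (fun q => exist _ (_, _) (h q)); split=> [|q|q].
- exists (fun q => exist _ (_, _) (k q)) => q; apply: pullback_inj.
    case: q h => -[[s t] z] /= e h.
    by rewrite /st /= (bK _).1 e.
  case: q k => -[z [t s]] /= e k.
  rewrite /src /= (bK _).2; congr pair.
  (* The point [z] in the apex of the twist is recovered from its image, since the twist function is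
     injective. *)
  apply: (can_inj (@twist_funK m n)); rewrite e twist_fun_cat -db.
  by rewrite (bK _).2.
- by [].
- case: q h => -[[s t] z] /= e h.
  rewrite -e twist_fun_cat /src /= cb; congr cat_tuple; apply: val_inj => /=.
  by apply: eq_map => y; apply: lconjg_center; exact: zS.
Qed.


(** * Arrows as isomorphism classes *)

Lemma tspan_memE m n (f : tspan G m n) S : f S -> tspan_class f = span_iso S.
Proof.
case: (tspan_classP f) => S0 _ -> S0S; apply/funext => T; apply/propext.
by split; apply: span_iso_trans => //; exact: span_iso_sym.
Qed.

(** The means of proving every equation between arrows below: choose a representative of each side
    and give an isomorphism of spans. Extensionality turns this into equality of classes. *)
Lemma tspan_eq m n (f g : tspan G m n) S T :
  f S -> g T -> span_iso S T -> f = g.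
Proof.
move=> fS gT ST; have : tspan_class f = tspan_class g.
  rewrite (tspan_memE fS) (tspan_memE gT); apply/funext => U; apply/propext.
  by split; apply: span_iso_trans => //; exact: span_iso_sym.
case: f g {fS gT} => [F hF] [F' hF'] /= eF; subst F'.
by rewrite (Prop_irrelevance hF hF').
Qed.

Lemma tspan_mem_iso m n (f : tspan G m n) S T : f S -> span_iso S T -> f T.
Proof. by move=> /tspan_memE->. Qed.

Lemma tspan_rep m n (f : tspan G m n) : exists2 S, is_tspan S & f S.
Proof.
case: (tspan_classP f) => S tS ->; exists S => //; exact: span_iso_refl.
Qed.

Definition class_of m n (S : span (m.-tuple G) (n.-tuple G))
  (tS : is_tspan S) : tspan G m n := TSpan (ex_intro2 _ _ S tS erefl).

Lemma mem_class_of m n (S : span (m.-tuple G) (n.-tuple G))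
  (tS : is_tspan S) : class_of tS S.
Proof. exact: span_iso_refl. Qed.

(** The composite class is the isomorphism closure of the composites of all members, so no
    representative is chosen; [span_comp_iso] shows that it is a single class. *)
Lemma comp_classP m n p (g : tspan G n p) (f : tspan G m n) :
  exists2 S, is_tspan S &
    (fun U => exists S T, [/\ f S, g T & span_iso (span_comp T S) U])
    = span_iso S.
Proof.
have [S tS fS] := tspan_rep f; have [T tT gT] := tspan_rep g.
exists (span_comp T S); first exact: is_tspan_comp.
apply/funext => U; apply/propext; split; last by exists S, T.
case=> [S' [T' []]]; rewrite (tspan_memE fS) (tspan_memE gT) => SS' TT'.
by apply: span_iso_trans; apply: span_comp_iso.
Qed.

Definition tspan_comp m n p (g : tspan G n p) (f : tspan G m n) :=
  TSpan (comp_classP g f).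

Lemma tspan_compP m n p (g : tspan G n p) (f : tspan G m n) T S :
  g T -> f S -> tspan_comp g f (span_comp T S).
Proof. by move=> gT fS; exists S, T; split=> //; exact: span_iso_refl. Qed.

Lemma prod_classP m n m' n' (f : tspan G m m') (g : tspan G n n') :
  exists2 S, is_tspan S &
    (fun U => exists S T, [/\ f S, g T & span_iso (span_prod S T) U])
    = span_iso S.
Proof.
have [S tS fS] := tspan_rep f; have [T tT gT] := tspan_rep g.
exists (span_prod S T); first exact: is_tspan_prod.
apply/funext => U; apply/propext; split; last by exists S, T.
case=> [S' [T' []]]; rewrite (tspan_memE fS) (tspan_memE gT) => SS' TT'.
by apply: span_iso_trans; apply: span_prod_iso.
Qed.

Definition tspan_prod m n m' n' (f : tspan G m m') (g : tspan G n n') :=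
  TSpan (prod_classP f g).

Lemma tspan_prodP m n m' n' (f : tspan G m m') (g : tspan G n n') S T :
  f S -> g T -> tspan_prod f g (span_prod S T).
Proof. by move=> fS gT; exists S, T; split=> //; exact: span_iso_refl. Qed.

Lemma tspan_castP m m' n n' (em : m = m') (en : n = n') (f : tspan G m n) S :
  f S -> tspan_class (hom_cast em en f) (span_cast em en S).
Proof. by case: _ / em; case: _ / en => /=; case: S. Qed.

Definition tspan_id n : tspan G n n := class_of (is_tspan_id n).

(** * The category laws *)

Lemma tspan_comp1l m n (f : tspan G m n) : tspan_comp (tspan_id n) f = f.
Proof.
have [S _ fS] := tspan_rep f.
apply: tspan_eq (tspan_compP (mem_class_of _) fS) fS _; exact: span_comp1l.
Qed.

Lemma tspan_comp1r m n (f : tspan G m n) : tspan_comp f (tspan_id m) = f.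
Proof.
have [S _ fS] := tspan_rep f.
apply: tspan_eq (tspan_compP fS (mem_class_of _)) fS _; exact: span_comp1r.
Qed.

Lemma tspan_compA m n p q (h : tspan G p q) (g : tspan G n p)
    (f : tspan G m n) :
  tspan_comp h (tspan_comp g f) = tspan_comp (tspan_comp h g) f.
Proof.
have [S _ fS] := tspan_rep f; have [T _ gT] := tspan_rep g.
have [U _ hU] := tspan_rep h.
apply: tspan_eq (tspan_compP hU (tspan_compP gT fS))
  (tspan_compP (tspan_compP hU gT) fS) _; exact: span_compA.
Qed.

Definition tspan_category : category (tspan G) :=
  Category tspan_comp1l tspan_comp1r tspan_compA.

(** * The strict monoidal structure *)

Lemma tspan_prod_id m n :
  tspan_prod (tspan_id m) (tspan_id n) = tspan_id (m + n).
Proof.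
apply: tspan_eq (tspan_prodP (mem_class_of _) (mem_class_of _))
  (mem_class_of _) _.
exact: span_prod_id.
Qed.

Lemma tspan_prod_comp m n m' n' m'' n''
    (f' : tspan G m' m'') (g' : tspan G n' n'')
    (f : tspan G m m') (g : tspan G n n') :
  tspan_prod (tspan_comp f' f) (tspan_comp g' g)
  = tspan_comp (tspan_prod f' g') (tspan_prod f g).
Proof.
have [S _ fS] := tspan_rep f; have [T _ gT] := tspan_rep g.
have [S' _ fS'] := tspan_rep f'; have [T' _ gT'] := tspan_rep g'.
apply: tspan_eq (tspan_prodP (tspan_compP fS' fS) (tspan_compP gT' gT))
  (tspan_compP (tspan_prodP fS' gT') (tspan_prodP fS gT)) _.
exact: span_prod_comp.
Qed.

(** Products of apexes are associative only up to rebracketing, but this bijection is an isomorphism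
    of spans, hence an equality of arrows. The casts on the legs do not change the underlying
    sequences. *)
Lemma tspan_prodA m n p m' n' p'
    (f : tspan G m m') (g : tspan G n n') (h : tspan G p p') :
  hom_cast (addnA m n p) (addnA m' n' p') (tspan_prod f (tspan_prod g h))
  = tspan_prod (tspan_prod f g) h.
Proof.
have [S _ fS] := tspan_rep f; have [T _ gT] := tspan_rep g.
have [U _ hU] := tspan_rep h.
apply: tspan_eq (tspan_castP _ _ (tspan_prodP fS (tspan_prodP gT hU)))
  (tspan_prodP (tspan_prodP fS gT) hU) _.
exists (fun q => ((q.1, q.2.1), q.2.2)); split=> [|[s [t u]]|[s [t u]]].
- by exists (fun q => (q.1.1, (q.1.2, q.2))) => [[s [t u]]|[[s t] u]].
- by apply: val_inj; rewrite /= val_tcast /= catA.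
- by apply: val_inj; rewrite /= val_tcast /= catA.
Qed.

Lemma tspan_prod1l m n (f : tspan G m n) :
  hom_cast (add0n m) (add0n n) (tspan_prod (tspan_id 0) f) = f.
Proof.
have [S _ fS] := tspan_rep f.
apply: tspan_eq (tspan_castP _ _ (tspan_prodP (mem_class_of _) fS)) fS _.
exists (fun q => q.2); split=> [|[e s]|[e s]].
- exists (fun s : apex S => ([tuple] : 0.-tuple G, s)) => [[e s]|//].
  by rewrite [e]tuple0.
- by apply: val_inj; rewrite /= val_tcast [e]tuple0.
- by apply: val_inj; rewrite /= val_tcast [e]tuple0.
Qed.

Lemma tspan_prod1r m n (f : tspan G m n) :
  hom_cast (addn0 m) (addn0 n) (tspan_prod f (tspan_id 0)) = f.
Proof.
have [S _ fS] := tspan_rep f.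
apply: tspan_eq (tspan_castP _ _ (tspan_prodP fS (mem_class_of _))) fS _.
exists (fun q => q.1); split=> [|[s e]|[s e]].
- exists (fun s : apex S => (s, [tuple] : 0.-tuple G)) => [[s e]|//].
  by rewrite [e]tuple0.
- by apply: val_inj; rewrite /= val_tcast [e]tuple0 /= cats0.
- by apply: val_inj; rewrite /= val_tcast [e]tuple0 /= cats0.
Qed.

Definition tspan_monoidal : strict_monoidal tspan_category addn 0 :=
  @StrictMonoidal _ _ tspan_category addn 0 tspan_prod tspan_prod_id
    tspan_prod_comp addnA add0n addn0 tspan_prodA tspan_prod1l tspan_prod1r.

(** * The braiding and its coherence *)

Definition twist m n : tspan G (m + n) (n + m) :=
  class_of (is_tspan_twist m n).

Lemma twist_iso m n : exists t : tspan G (n + m) (m + n),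
  tspan_comp t (twist m n) = tspan_id (m + n)
  /\ tspan_comp (twist m n) t = tspan_id (n + m).
Proof.
exists (class_of (is_tspan_untwist m n)).
split; apply: tspan_eq (tspan_compP (mem_class_of _) (mem_class_of _))
  (mem_class_of _) _; apply: span_iso_trans (span_of_fun_comp _ _) _;
  apply: eq_span_of_fun.
- exact: twist_funK.
- exact: untwist_funK.
Qed.

Lemma twist_natural m n m' n' (f : tspan G m m') (g : tspan G n n') :
  tspan_comp (twist m' n') (tspan_prod f g)
  = tspan_comp (tspan_prod g f) (twist m n).
Proof.
have [S tS fS] := tspan_rep f; have [T tT gT] := tspan_rep g.
apply: tspan_eq (tspan_compP (mem_class_of _) (tspan_prodP fS gT))
  (tspan_compP (tspan_prodP gT fS) (mem_class_of _)) _.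
exact: span_twist_natural.
Qed.

(** With the next two lemmas, it computes casts, composites and products of arrows represented by
    functions; the coherence laws then become pointwise identities. *)
Lemma tspan_castP_fun m m' n n' (em : m = m') (en : n = n')
    (f : tspan G m n) (F : m.-tuple G -> n.-tuple G) :
  f (span_of_fun F) ->
  tspan_class (hom_cast em en f)
    (span_of_fun (fun z => tcast en (F (tcast (esym em) z)))).
Proof.
move=> fF; apply: tspan_mem_iso (tspan_castP em en fF) _.
exact: span_cast_of_fun.
Qed.

Lemma tspan_compP_fun m n p (g : tspan G n p) (f : tspan G m n)
    (K : n.-tuple G -> p.-tuple G) (F : m.-tuple G -> n.-tuple G) :
  g (span_of_fun K) -> f (span_of_fun F) ->
  tspan_comp g f (span_of_fun (K \o F)).
Proof.
move=> gK fF; apply: tspan_mem_iso (tspan_compP gK fF) _.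
exact: span_of_fun_comp.
Qed.

Lemma tspan_prodP_fun m n m' n' (f : tspan G m m') (g : tspan G n n')
    (F : m.-tuple G -> m'.-tuple G) (K : n.-tuple G -> n'.-tuple G) :
  f (span_of_fun F) -> g (span_of_fun K) ->
  tspan_prod f g
    (span_of_fun (fun z => cat_tuple (F (ltuple z)) (K (rtuple z)))).
Proof.
move=> fF gK; apply: tspan_mem_iso (tspan_prodP fF gK) _.
exact: span_prod_of_fun.
Qed.

Lemma cat_tuple3 m n p (z : (m + n + p).-tuple G) :
  exists (x : m.-tuple G) (y : n.-tuple G) (w : p.-tuple G),
    z = cat_tuple (cat_tuple x y) w.
Proof.
exists (ltuple (ltuple z)), (rtuple (ltuple z)), (rtuple z).
by rewrite !cat_ltuple_rtuple.
Qed.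

Lemma tcast_catA m n p (e : m + n + p = m + (n + p))
    (x : m.-tuple G) (y : n.-tuple G) (w : p.-tuple G) :
  tcast e (cat_tuple (cat_tuple x y) w) = cat_tuple x (cat_tuple y w).
Proof. by apply: val_inj; rewrite /= val_tcast /= catA. Qed.

Lemma tcast_catAr m n p (e : m + (n + p) = m + n + p)
    (x : m.-tuple G) (y : n.-tuple G) (w : p.-tuple G) :
  tcast e (cat_tuple x (cat_tuple y w)) = cat_tuple (cat_tuple x y) w.
Proof. by apply: val_inj; rewrite /= val_tcast /= catA. Qed.

Lemma map_cat_tuple (h : G -> G) m n (x : m.-tuple G) (y : n.-tuple G) :
  map_tuple h (cat_tuple x y) = cat_tuple (map_tuple h x) (map_tuple h y).
Proof. by apply: val_inj; rewrite /= map_cat. Qed.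

(** On blocks, the right side sends [(x, y, w)] to [(y^x, x, w)] and then to [(y^x, w^x, x)]; the
    left side gives the same at once because conjugation acts entrywise. *)
Lemma twist_tensr m n p :
  hom_cast (addnA m n p) (esym (addnA n p m)) (twist m (n + p))
  = tspan_comp (tspan_prod (tspan_id n) (twist m p))
      (hom_cast (erefl _) (esym (addnA n m p))
        (tspan_prod (twist m n) (tspan_id p))).
Proof.
apply: tspan_eq (tspan_castP_fun _ _ (mem_class_of _))
  (tspan_compP_fun
    (tspan_prodP_fun (mem_class_of _) (mem_class_of _))
    (tspan_castP_fun _ _
      (tspan_prodP_fun (mem_class_of _) (mem_class_of _)))) _.
apply: eq_span_of_fun => z /=; have [x [y [w ->]]] := cat_tuple3 z.
rewrite tcast_catA twist_fun_cat map_cat_tuple tcast_catA.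
by rewrite !(ltuple_cat, rtuple_cat, twist_fun_cat, tcast_catA).
Qed.

(** On blocks, the left side conjugates [w] by the product of [x] and [y] together, the right side
    by that of [y] and then by that of [x]; [lconjgM] identifies the two. *)
Lemma twist_tensl m n p :
  hom_cast (esym (addnA m n p)) (addnA p m n) (twist (m + n) p)
  = tspan_comp (tspan_prod (twist m p) (tspan_id n))
      (hom_cast (erefl _) (addnA m p n)
        (tspan_prod (tspan_id m) (twist n p))).
Proof.
apply: tspan_eq (tspan_castP_fun _ _ (mem_class_of _))
  (tspan_compP_fun
    (tspan_prodP_fun (mem_class_of _) (mem_class_of _))
    (tspan_castP_fun _ _
      (tspan_prodP_fun (mem_class_of _) (mem_class_of _)))) _.
apply: eq_span_of_fun => z /=.
have [x [y [w ->]]] : exists (x : m.-tuple G) (y : n.-tuple G)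
    (w : p.-tuple G), z = cat_tuple x (cat_tuple y w).
  exists (ltuple z), (ltuple (rtuple z)), (rtuple (rtuple z)).
  by rewrite !cat_ltuple_rtuple.
rewrite tcast_catAr twist_fun_cat tcast_catAr.
rewrite !(ltuple_cat, rtuple_cat, twist_fun_cat, tcast_catAr).
congr (cat_tuple (cat_tuple _ _) _); apply: val_inj => /=.
rewrite -map_comp; apply: eq_map => a /=.
by rewrite -lconjgM /tprod /= big_cat.
Qed.

Definition tspan_braided : braided tspan_monoidal :=
  @Braided _ _ tspan_category addn 0 tspan_monoidal twist twist_iso
    twist_natural twist_tensr twist_tensl.

End TSpan.

(** An arrow is determined by any member of its class, so the four membership clauses pin down
    identities, composition, tensor and twist. *)
Theorem theorem4p1 (G : groupType) :
  exists (C : category (tspan G)) (M : strict_monoidal C addn 0)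
         (B : braided M),
    [/\ forall n, idm C n (span_id (n.-tuple G)),
        forall m n p (g : tspan G n p) (f : tspan G m n) T S,
          g T -> f S -> compm C g f (span_comp T S),
        forall m n m' n' (f : tspan G m m') (g : tspan G n n') S T,
          f S -> g T -> tensm M f g (span_prod S T)
      & forall m n, braid B m n (twist_span G m n)].
Proof.
exists (tspan_category G), (tspan_monoidal G), (tspan_braided G); split.
- by move=> n; exact: mem_class_of.
- exact: tspan_compP.
- exact: tspan_prodP.
- by move=> m n; exact: mem_class_of.
Qed.
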